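(* $m(3)=10$; that is, the smallest number of edges of a minimal uncolorable $3$-uniform bi-hypergraph is $10$.
   Context: A bi-hypergraph $\mathcal H=(V,E)$ consists of a finite vertex set $V$ and a set $E$ of subsets of $V$, called edges, with no edge contained in another. It is $r$-uniform if every edge has exactly $r$ elements. A mapping $f:V\to\mathbb N$ is a proper coloring of $\mathcal H$ if $1<|f(e)|<|e|$ for every $e\in E$, where $f(e)=\{f(v):v\in e\}$. $\mathcal H$ is colorable if it has a proper coloring, and uncolorable otherwise. A subhypergraph of $\mathcal H$ is a bi-hypergraph $(V',E')$ with $V'\subseteq V$, $E'\subseteq E$. $\mathcal H$ is minimal uncolorable if it is uncolorable but every proper subhypergraph of it is colorable. $m(r)$ denotes the smallest positive integer $m$ for which there exists a minimal uncolorable $r$-uniform bi-hypergraph with exactly $m$ edges. *)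

(* Defs.v *)
From mathcomp Require Import all_boot.
Set Implicit Arguments. Unset Strict Implicit. Unset Printing Implicit Defensive.

Definition is_bihypergraph (T : finType) (V : {set T}) (E : {set {set T}}) : Prop :=
  (forall e, e \in E -> e \subset V) /\
  (forall e e', e \in E -> e' \in E -> e \subset e' -> e = e').

Definition uniform (T : finType) (r : nat) (E : {set {set T}}) : Prop :=
  forall e, e \in E -> #|e| = r.

Definition ncolors (T : finType) (f : T -> nat) (e : {set T}) : nat :=
  size (undup (map f (enum e))).

Definition proper_coloring (T : finType) (E : {set {set T}}) (f : T -> nat) : Prop :=
  forall e, e \in E -> 1 < ncolors f e < #|e|.

(* colorability of (V,E): a coloring V -> N; values of f outside V are irrelevant
   since all edges lie inside V *)
Definition colorable (T : finType) (V : {set T}) (E : {set {set T}}) : Prop :=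
  exists f : T -> nat, proper_coloring E f.

Definition uncolorable (T : finType) (V : {set T}) (E : {set {set T}}) : Prop :=
  ~ colorable V E.

Definition subhypergraph (T : finType) (V' : {set T}) (E' : {set {set T}})
    (V : {set T}) (E : {set {set T}}) : Prop :=
  V' \subset V /\ E' \subset E /\ is_bihypergraph V' E'.

Definition minimal_uncolorable (T : finType) (V : {set T}) (E : {set {set T}}) : Prop :=
  is_bihypergraph V E /\ uncolorable V E /\
  (forall V' E', subhypergraph V' E' V E -> (V', E') <> (V, E) -> colorable V' E').

Definition has_MU (r m : nat) : Prop :=
  exists (T : finType) (E : {set {set T}}),
    minimal_uncolorable [set: T] E /\ uniform r E /\ #|E| = m.

Definition m_is (r k : nat) : Prop :=
  0 < k /\ has_MU r k /\ (forall m, 0 < m -> has_MU r m -> k <= m).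

(* Main.v *)
Require Import Defs.
From mathcomp Require Import all_boot zify.

(** The complete 3-graph on five vertices is minimal uncolorable. Conversely let
    [E] consist of at most nine triples. Two vertices lying in no common edge can
    be identified, so one may assume that all pairs are covered. On at most six
    vertices there are ten splittings into two triples and each edge spoils only
    one of them. On at least seven vertices some vertex [v] has degree at most 3,
    which forces exactly seven vertices, the link of [v] being a perfect matching
    [A, B, C]. If [E] is uncolorable then each of the colorings {v}, A, B u C
    (and its two analogues) forces an edge inside B u C (resp. the analogues), and
    each of the four splittings of A u B u C into two transversals forces a
    transversal edge: together with the edges at [v] this makes ten edges. *)

Definition incidence {T : finType} (s : seq T) (e : {set T}) : bitseq :=
  [seq x \in e | x <- s].

(** * Color counts and their behavior under vertex maps *)

Section Ncolors.

Variables (T T' : finType).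

Lemma ncolors_comp (g : T -> T') (f : T' -> nat) (e : {set T}) :
  ncolors (f \o g) e = ncolors f (g @: e).
Proof.
apply: perm_size; apply: uniq_perm; rewrite ?undup_uniq // => c.
rewrite !mem_undup; apply/mapP/mapP => [[x xe ->]|[y]].
  by exists (g x) => //; rewrite mem_enum imset_f // -mem_enum.
by rewrite mem_enum => /imsetP[x xe ->] ->; exists x; rewrite ?mem_enum.
Qed.

Lemma ncolors_gt1 (f : T -> nat) (e : {set T}) x y :
  x \in e -> y \in e -> f x != f y -> 1 < ncolors f e.
Proof.
move=> xe ye fxy; apply: (@uniq_leq_size _ [:: f x; f y]).
  by rewrite /= inE fxy.
by move=> c; rewrite !inE mem_undup => /orP[] /eqP->; rewrite map_f ?mem_enum.
Qed.

(** Turns the color count of an edge into a list expression that can be evaluated, the coloring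
    being listed along [s]. *)
Lemma ncolors_mask (s c : seq _) (e : {set T}) :
    uniq s -> s =i T -> size c = size s ->
  ncolors (fun x => nth 0 c (index x s)) e =
  size (undup (mask (incidence s e) c)).
Proof.
move=> Us sT szc; apply/perm_size/perm_undup/perm_mem.
have fs : [seq nth 0 c (index x s) | x <- s] = c.
  case: s Us {sT} szc => [|x0 s] Us szc; first by case: c szc.
  apply: (@eq_from_nth _ 0) => [|i]; rewrite size_map // => lti.
  by rewrite (nth_map x0) // index_uniq.
rewrite -[X in mask _ X]fs -map_mask -filter_mask; apply: perm_map.
apply: uniq_perm; rewrite ?enum_uniq ?filter_uniq // => x.
by rewrite mem_filter mem_enum sT andbT.
Qed.

Lemma ncolors_set_seq (f : T -> nat) (s : seq T) :
  uniq s -> ncolors f [set x in s] = size (undup (map f s)).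
Proof.
move=> Us; apply/perm_size/perm_undup/perm_mem/perm_map/uniq_perm => //.
  exact: enum_uniq.
by move=> x; rewrite mem_enum inE.
Qed.

Lemma count_incidence (s : seq T) (e : {set T}) :
  uniq s -> s =i T -> count id (incidence s e) = #|e|.
Proof.
move=> Us sT; rewrite cardE count_map -size_filter.
apply: perm_size; apply: uniq_perm; rewrite ?enum_uniq ?filter_uniq // => x.
by rewrite mem_filter mem_enum sT andbT.
Qed.

(** Colorings pull back along [g]. This serves both for embedding into a larger vertex set and for
    identifying two vertices. *)
Lemma colorable_image (g : T -> T') (E : {set {set T}}) :
    {in E, forall e : {set T}, {in e &, injective g}} ->
  colorable [set: T'] [set g @: e | e : {set T} in E] -> colorable [set: T] E.
Proof.
move=> inj_g [f fP]; exists (f \o g) => e eE.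
rewrite ncolors_comp -(card_in_imset (inj_g e eE)); apply: fP.
exact: imset_f.
Qed.

Lemma uniform_image r (g : T -> T') (E : {set {set T}}) :
    {in E, forall e : {set T}, {in e &, injective g}} ->
  uniform r E -> uniform r [set g @: e | e : {set T} in E].
Proof.
by move=> inj_g E3 _ /imsetP[e eE ->]; rewrite card_in_imset ?E3 //; apply: inj_g.
Qed.

End Ncolors.

(** * At most six vertices *)

Lemma two_coloring (T : finType) (E : {set {set T}}) (A : {set T}) :
    uniform 3 E -> {in E, forall e : {set T}, ~~ (e \subset A) && ~~ (e \subset ~: A)} ->
  colorable [set: T] E.
Proof.
move=> E3 EA; exists (fun x => x \in A) => e eE; rewrite E3 //.
have /andP[/subsetPn[x xe xA] /subsetPn[y ye yA]] := EA e eE.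
apply/andP; split.
  by apply: (ncolors_gt1 _ _ _ x y) => //; move: yA; rewrite (negbTE xA) !inE negbK => ->.
apply: (@uniq_leq_size _ _ [:: 0; 1]); first exact: undup_uniq.
by move=> c; rewrite mem_undup => /mapP[z _ ->]; case: (z \in A).
Qed.

Lemma colorable_6 (T : finType) (E : {set {set T}}) :
  #|T| = 6 -> uniform 3 E -> #|E| <= 9 -> colorable [set: T] E.
Proof.
move=> T6 E3 E9.
(* There are 20 triples, but at most 9 + 9 edges and complements of edges. *)
have : ~~ ([set A : {set T} | #|A| == 3] \subset E :|: [set ~: e | e : {set T} in E]).
  apply: contraTN isT => /subset_leq_card; rewrite card_draws T6.
  move=> /leq_trans/(_ (leq_card_setU _ _)).
  by move=> /leq_trans/(_ (leq_add E9 (leq_trans (leq_imset_card _ _) E9))).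
case/subsetPn => A; rewrite !inE => /eqP A3; rewrite negb_or => /andP[AE cAE].
apply: (two_coloring _ _ A) => // e eE; apply/andP; split.
  apply: contra AE => eA; suff <- : e = A by [].
  by apply/eqP; rewrite eqEcard eA A3 E3.
apply: contra cAE => eA; apply/imsetP; exists e => //.
suff -> : e = ~: A by rewrite setCK.
apply/eqP; rewrite eqEcard eA (E3 e eE).
by have := cardsC A; rewrite A3 T6 -[6]/(3 + 3) => /addnI->.
Qed.

(** Isolated vertices are added to reach exactly six. *)
Lemma colorable_le6 (T : finType) (E : {set {set T}}) :
  #|T| <= 6 -> uniform 3 E -> #|E| <= 9 -> colorable [set: T] E.
Proof.
move=> T6 E3 E9; pose g (x : T) := widen_ord T6 (enum_rank x).
have inj_g : injective g.
  by move=> x y /(congr1 val) /= /val_inj; apply: enum_rank_inj.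
have inj_gE : {in E, forall e : {set T}, {in e &, injective g}}.
  by move=> e _; apply: in2W.
apply: (colorable_image _ _ g) => //; apply: colorable_6; rewrite ?card_ord //.
  exact: uniform_image.
exact: leq_trans (leq_imset_card _ _) E9.
Qed.

Lemma colorable_merge (T : finType) (E : {set {set T}}) (x y : T) :
    x != y -> ~~ [exists e in E, (x \in e) && (y \in e)] ->
    uniform 3 E ->
    (forall (T' : finType) (E' : {set {set T'}}),
       #|T'| < #|T| -> uniform 3 E' -> #|E'| <= #|E| -> colorable [set: T'] E') ->
  colorable [set: T] E.
Proof.
move=> xy nE E3 IH.
(* The default value of [insubd] is [x], so [g] sends [y] to [x] and fixes every other vertex. *)
pose g (z : T) : {z | z != y} := insubd (exist _ x xy) z.
have gE z : val (g z) = if z == y then x else z.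
  by rewrite val_insubd; case: (z == y).
have inj_g : {in E, forall e : {set T}, {in e &, injective g}}.
  move=> e eE u w ue we /(congr1 val); rewrite !gE.
  have nxy : x \in e -> y \in e -> False.
    by move=> xe ye; case/existsP: nE; exists e; rewrite eE xe ye.
  have [uy | _] := eqVneq u y; have [wy | _] := eqVneq w y => //.
  - by rewrite uy wy.
  - by move=> xw; case: nxy; rewrite ?xw -?uy.
  - by move=> ux; case: nxy; rewrite -?ux -?wy.
apply: (colorable_image _ _ g) => //; apply: IH.
- by rewrite card_sig cardC1 prednK //; apply/card_gt0P; exists x.
- exact: uniform_image.
- exact: leq_imset_card.
Qed.

(* The vertices are listed as [v, a1, a2, b1, b2, c1, c2]; an edge is encoded by
   its characteristic vector and a coloring by its list of values. *)
Definition links : seq bitseq :=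
  [:: [:: true; true; true; false; false; false; false];
      [:: true; false; false; true; true; false; false];
      [:: true; false; false; false; false; true; true]].

(** The link edges spoil none of these: in the last four, each matched pair already receives both
    colors, whatever the color of [v]. *)
Definition colorings : seq (seq nat) :=
  [:: [:: 0; 1; 1; 2; 2; 2; 2]; [:: 0; 2; 2; 1; 1; 2; 2]; [:: 0; 2; 2; 2; 2; 1; 1];
      [:: 0; 1; 0; 1; 0; 1; 0]; [:: 0; 1; 0; 1; 0; 0; 1];
      [:: 0; 1; 0; 0; 1; 1; 0]; [:: 0; 1; 0; 0; 1; 0; 1]].

Definition spoils (b : bitseq) (c : seq nat) := ~~ (1 < size (undup (mask b c)) < 3).

(* A triple avoiding [v] spoils at most one of the seven colorings, so [slot]
   separates the ten edges that an uncolorable [E] must contain. *)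
Definition slot (b : bitseq) : nat :=
  if b \in links then index b links else 3 + find (spoils b) colorings.

Definition vectors n := iter n (fun l => map (cons true) l ++ map (cons false) l) [:: [::]].

Lemma mem_vectors (b : bitseq) : b \in vectors (size b).
Proof.
elim: b => // -[] b IH; rewrite /= mem_cat; apply/orP; [left | right];
by rewrite mem_map // => ? ? [].
Qed.

(** An exhaustive check over the 128 Boolean vectors of length 7. *)
Lemma slot_spoils (b : bitseq) i :
    size b = 7 -> count id b = 3 -> (head false b -> b \in links) ->
    i < 7 -> spoils b (nth [::] colorings i) ->
  slot b = 3 + i.
Proof.
have : all (fun b => [==> count id b == 3, head false b ==> (b \in links) =>
    all (fun i => spoils b (nth [::] colorings i) ==> (slot b == 3 + i)) (iota 0 7)])
    (vectors 7) by vm_compute.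
move=> /allP H szb cb hb lti sp; have := H b; rewrite -{1}szb mem_vectors cb eqxx.
move=> /(_ isT); rewrite (introT implyP hb) => /allP/(_ i).
by rewrite mem_iota lti sp => /(_ isT)/eqP.
Qed.

Lemma colorable_links (T : finType) (E : {set {set T}}) (s : seq T) :
    uniq s -> s =i T -> size s = 7 -> uniform 3 E -> #|E| <= 9 ->
    {in E, forall e : {set T}, head false (incidence s e) -> incidence s e \in links} ->
    {in links, forall b, exists2 e, e \in E & incidence s e = b} ->
  colorable [set: T] E.
Proof.
move=> Us sT s7 E3 E9 Ev Elinks.
have count_E e : e \in E -> count id (incidence s e) = 3.
  by move=> eE; rewrite count_incidence ?E3.
(* At most nine edges cannot fill ten slots. An empty slot [k < 3] would be a missing link edge;
   otherwise the coloring of index [k - 3] is spoiled by no edge. *)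
have /allPn[k] : ~~ all [in [seq slot (incidence s e) | e in E]] (iota 0 10).
  apply: contraTN isT => /allP/(uniq_leq_size (iota_uniq 0 10)).
  by rewrite size_iota size_image leqNgt ltnS E9.
rewrite mem_iota /= => k10 kE.
have [k3 | k3] := ltnP k 3.
  have [e eE ce] := Elinks (nth [::] links k) (mem_nth _ (k3 : k < size links)).
  case/imageP: kE; exists e => //; rewrite ce.
  by case: k k3 {k10 ce} => [|[|[|]]].
exists (fun x => nth 0 (nth [::] colorings (k - 3)) (index x s)) => e eE.
rewrite E3 // ncolors_mask //; last first.
  rewrite s7; apply/eqP; have /all_nthP : all (fun c => size c == 7) colorings by [].
  by apply; rewrite ltn_subLR.
apply: contraR kE => sp; apply/imageP; exists e => //.
rewrite (@slot_spoils _ (k - 3)) ?subnKC // ?size_map ?count_E //; first exact: Ev.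
by rewrite ltn_subLR.
Qed.

(** * More than six vertices, all pairs covered *)

Lemma card_incidence (T : finType) (E : {set {set T}}) r :
  uniform r E -> \sum_(x : T) #|[set e in E | x \in e]| = r * #|E|.
Proof.
move=> Er.
under eq_bigr => x _ do rewrite -sum1dep_card.
rewrite (exchange_big_dep [in E]) /=; last by move=> x e _ /andP[].
rewrite mulnC -sum_nat_const; apply: eq_bigr => e eE.
by rewrite -(Er e eE) -sum1_card; apply: eq_bigl => x; rewrite eE.
Qed.

Lemma colorable_covered (T : finType) (E : {set {set T}}) :
    6 < #|T| -> uniform 3 E -> #|E| <= 9 ->
    (forall x y : T, x != y -> exists2 e, e \in E & (x \in e) && (y \in e)) ->
  colorable [set: T] E.
Proof.
move=> T7 E3 E9 cov.
(* If all degrees were at least 4, double counting would give [4 * #|T| <= 27]. *)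
have [v Dv] : exists v : T, #|[set e in E | v \in e]| <= 3.
  apply/existsP; apply: contraTT T7; rewrite negb_exists -leqNgt => /forallP H.
  have : \sum_(x : T) 4 <= 3 * #|E|.
    by rewrite -card_incidence //; apply: leq_sum => x _; rewrite ltnNge.
  rewrite sum_nat_const => /leq_trans/(_ (leq_mul (leqnn 3) E9)).
  by case: #|T| => [|[|[|[|[|[|[|n]]]]]]].
set D := [set e in E | v \in e] in Dv.
have DE e : e \in D -> (e \in E) * (v \in e) by rewrite inE => /andP[-> ->].
pose s := v :: flatten [seq enum (e :\ v) | e <- enum D].
have sT : s =i T.
  move=> x; rewrite inE; case: eqVneq => //= xv.
  have [e eE /andP[xe ve]] := cov x v xv.
  apply/flatten_mapP; exists e; first by rewrite mem_enum inE eE.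
  by rewrite mem_enum !inE xv.
have cardD1 e : e \in D -> #|e :\ v| = 2.
  by move=> /DE eE; have := cardsD1 v e; rewrite E3 eE // => -[].
have szs : size s = (2 * #|D|).+1.
  rewrite /= size_flatten /shape -map_comp; congr _.+1.
  rewrite sumnE big_map big_enum mulnC -sum_nat_const.
  by apply: eq_bigr => e eD; rewrite /= -cardE cardD1.
(* Since [s] reaches at least seven vertices with [2 * #|D| + 1 <= 7] entries, equality holds
   throughout and [s] has no repetition. *)
have leTs : #|T| <= size s.
  by rewrite cardE; apply: uniq_leq_size (enum_uniq T) _ => x _; rewrite sT.
have D3 : #|D| = 3.
  apply/eqP; rewrite eqn_leq Dv leqNgt; apply: contraTN (leq_trans T7 leTs).
  by rewrite szs; case: #|D| => [|[|[|]]].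
have s7 : size s = 7 by rewrite szs D3.
have Us : uniq s.
  apply: leq_size_uniq (enum_uniq T) _ _ => [x _|]; first by rewrite sT.
  by rewrite -cardE s7.
have incD : [seq incidence s e | e <- enum D] = links.
  have : all (fun e : {set T} => [&& v \in e, all (mem e) (enum (e :\ v)),
      size (enum (e :\ v)) == 2 & count id (incidence s e) == 3]) (enum D).
    apply/allP => e; rewrite mem_enum => eD.
    rewrite -cardE cardD1 // count_incidence // E3 ?DE //= andbT.
    by apply/allP => x; rewrite mem_enum => /setD1P[].
  (* Each of the three edges contains [v] and its own two entries of [s]; having only three
     vertices, it contains no other entry. *)
  move: D3; rewrite cardE /incidence /s; case: (enum D) => [|e1 [|e2 [|e3 []]]] //= _.
  case: (enum (e1 :\ v)) => [|x1 [|y1 [|? ?]]] /=; rewrite ?(andbF, andFb) //.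
  case: (enum (e2 :\ v)) => [|x2 [|y2 [|? ?]]] /=; rewrite ?(andbF, andFb) //.
  case: (enum (e3 :\ v)) => [|x3 [|y3 [|? ?]]] /=; rewrite ?(andbF, andFb) //.
  rewrite !andbT => /and3P[/and3P[-> /andP[-> ->] +] /and3P[-> /andP[-> ->] +]].
  move=> + + /and3P[-> /andP[-> ->]].
  do 4! case: (_ \in e1) => //; do 4! case: (_ \in e2) => //.
  by do 4! case: (_ \in e3).
apply: (colorable_links _ _ s) => // [e eE ve | b].
  by rewrite -incD map_f // mem_enum inE eE.
by rewrite -incD => /mapP[e]; rewrite mem_enum => eD ->; exists e; rewrite ?DE.
Qed.

(** Induction on the number of vertices, which merging lowers without adding edges. *)
Lemma colorable_le9 (T : finType) (E : {set {set T}}) :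
  uniform 3 E -> #|E| <= 9 -> colorable [set: T] E.
Proof.
have [n] := ubnP #|T|; elim: n => // n IH in T E *; rewrite ltnS => Tn E3 E9.
have [T6 | T7] := leqP #|T| 6; first exact: colorable_le6.
have [/forallP cov | /forallPn[x /forallPn[y]]] := boolP [forall x : T, forall y : T,
    (x != y) ==> [exists e in E, (x \in e) && (y \in e)]].
  apply: colorable_covered => // x y xy.
  have /exists_inP[e eE xye] := implyP (forallP (cov x) y) xy.
  by exists e.
rewrite negb_imply => /andP[xy nE]; apply: (colorable_merge _ _ _ _ xy nE) => //.
move=> T' E' T'T E'3 E'E; apply: IH => //; last exact: leq_trans E9.
exact: leq_trans Tn.
Qed.

(** * The extremal example *)

Lemma uncolorable_K5 : ~ colorable [set: 'I_5] [set e : {set 'I_5} | #|e| == 3].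
Proof.
case=> f fP.
(* Exactly two colors on a triple means exactly one monochromatic pair. *)
have one_pair (x y z : 'I_5) : uniq [:: x; y; z] ->
    (f x == f y) + (f x == f z) + (f y == f z) = 1.
  move=> U; have /fP : [set t in [:: x; y; z]] \in [set e : {set 'I_5} | #|e| == 3].
    by rewrite inE cardsE (card_uniqP U).
  rewrite ncolors_set_seq // cardsE (card_uniqP U) /= !inE.
  move: (f x) (f y) (f z) => a b c.
  case: (eqVneq a b) => [->|ab]; case: (eqVneq b c) => [<-|bc];
  by rewrite ?eqxx ?(negbTE ab) //; case: (eqVneq a c).
pose x i : 'I_5 := inord i.
have {}one_pair i j k : i < j < k -> k < 5 ->
    (f (x i) == f (x j)) + (f (x i) == f (x k)) + (f (x j) == f (x k)) = 1.
  case/andP=> ij jk k5; apply: one_pair.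
  rewrite /= !inE !andbT -!val_eqE /= !inordK //.
  - by rewrite negb_or !ltn_eqF // (ltn_trans ij).
  - exact: ltn_trans k5.
  - exact: ltn_trans (ltn_trans ij jk) k5.
(* Each of the ten triples contains exactly one monochromatic pair and each pair
   lies in three triples, but 3 does not divide 10. *)
move: (one_pair 0 1 2 isT isT) (one_pair 0 1 3 isT isT) (one_pair 0 1 4 isT isT)
  (one_pair 0 2 3 isT isT) (one_pair 0 2 4 isT isT) (one_pair 0 3 4 isT isT)
  (one_pair 1 2 3 isT isT) (one_pair 1 2 4 isT isT) (one_pair 1 3 4 isT isT)
  (one_pair 2 3 4 isT isT).
by do 10! move: (nat_of_bool (f _ == f _)) => ?; lia.
Qed.

Lemma has_MU_10 : has_MU 3 10.
Proof.
have K10 : #|[set e : {set 'I_5} | #|e| == 3]| = 10 by rewrite card_draws card_ord.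
exists 'I_5, [set e : {set 'I_5} | #|e| == 3]; split; last first.
  by split=> // e; rewrite inE => /eqP.
split; [split=> [e _|e e'] | split].
- exact: subsetT.
- rewrite !inE => /eqP e3 /eqP e'3 ee'; apply/eqP.
  by rewrite eqEcard ee' e3 e'3.
- exact: uncolorable_K5.
move=> V' E' [_ [sE [E'V _]]] neq.
apply: (@colorable_le9 _ E') => [e /(subsetP sE)|]; first by rewrite inE => /eqP.
rewrite -ltnS -K10; apply: proper_card; rewrite properEneq sE andbT.
apply: contra_notN neq => /eqP E'E; congr (_, _) => //.
apply/eqP; rewrite -subTset; apply: contraT => sV.
(* If all edges are kept but a vertex is dropped, at most four vertices would carry all ten
   triples. *)
have : #|[set e : {set 'I_5} | #|e| == 3]| <= 'C(#|V'|, 3).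
  rewrite -cards_draws; apply/subset_leq_card/subsetP => e eK.
  by move: (eK); rewrite !inE => ->; rewrite E'V ?E'E.
have : V' \proper [set: 'I_5] by rewrite properE subsetT.
move=> /proper_card; rewrite cardsT card_ord K10.
by case: #|V'| => [|[|[|[|[|n]]]]].
Qed.

Theorem theorem1p2 : m_is 3 10.
Proof.
split=> //; split=> [|m _ [T [E [[_ [ncol _]] [E3 <-]]]]]; first exact: has_MU_10.
by rewrite leqNgt; apply/negP => E9; apply: ncol; apply: colorable_le9.
Qed.
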